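(* Let $n\ge1$ and $1\le r\le n$. Then $X_r$ is a connected graph in $\mathcal{H}(n,2)$ with balanced fractional revival at time $\pi/8$ if and only if the following hold: (i) $n$ is odd, and $n-1\neq2^a(2^b-1)$ for any non-negative integers $a$ and $b$; (ii) the binary representation $(r-1)_2$ is obtained from $(n-1)_2$ by (a) keeping the $j$-th digit, for $j=0,1,\ldots,\alpha_2(n-1)$; (b) replacing exactly one substring ''$10$'' (two consecutive digits, both in positions greater than $\alpha_2(n-1)$) with ''$01$''; (c) replacing some (possibly none) of the remaining ''$1$''s of $(n-1)_2$, i.e. those not involved in (a) or (b), with ''$0$''s.
   Context: The graph $X_r$ in the binary Hamming scheme $\mathcal{H}(n,2)$ has as vertices the binary sequences of length $n$, two being adjacent iff their Hamming distance is exactly $r$. Let $U(t)=e^{-\mathrm{i}tA}$ where $A$ is the adjacency matrix of $X_r$. Balanced fractional revival at time $\tau$ means that there are vertices $a\ne b$ and complex $\alpha,\beta$ with $|\alpha|=|\beta|=1/\sqrt2$ and $U(\tau)\mathbf{e}_a=\alpha\mathbf{e}_a+\beta\mathbf{e}_b$. For a positive integer $m$, $\alpha_2(m)$ is the largest $k$ such that $2^k$ divides $m$, and $(m)_2$ is the binary representation of $m$; digit positions are counted from $0$ at the least significant digit, the substring ''$10$'' is read with the more significant digit first, and leading zeros in $(r-1)_2$ are allowed. *)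

(* Defs.v *)
From mathcomp Require Import all_boot all_order all_algebra complex.
From mathcomp Require Import boolp classical_sets reals topology normedtype.
From mathcomp Require Import sequences trigo.

Set Implicit Arguments.
Unset Strict Implicit.
Unset Printing Implicit Defensive.

Import Order.TTheory GRing.Theory Num.Theory.
Import numFieldNormedType.Exports.

Local Open Scope classical_set_scope.
Local Open Scope ring_scope.
Local Open Scope complex_scope.

(* Matrices with rows and columns indexed by a finite type T are rendered as
   'M_#|T|, the vertex x : T having index enum_rank x. *)
Definition adjmx (K : pzRingType) (T : finType) (e : rel T) : 'M[K]_#|T| :=
  \matrix_(i, j) (e (enum_val i) (enum_val j))%:R.

Definition vertex_vec (K : pzRingType) (T : finType) (x : T) : 'cV[K]_#|T| :=
  delta_mx (enum_rank x) 0.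

(* Entrywise limit of the partial sums of \sum_k M ^+ k / k`!; the cast to
   R[i]^o supplies the topology given by the modulus. *)
Definition mexp (R : realType) (m : nat) (M : 'M[R[i]]_m) : 'M[R[i]]_m :=
  \matrix_(i, j)
    lim ((fun N : nat =>
            (\sum_(0 <= k < N) (k`!%:R)^-1 *: M ^+ k) i j : R[i]^o) @ \oo).

Definition transition_mx (R : realType) (T : finType) (e : rel T) (t : R) :
    'M[R[i]]_#|T| :=
  mexp ((- ('i%C * t%:C)) *: adjmx R[i] e).

Definition balanced_fractional_revival
    (R : realType) (T : finType) (e : rel T) (tau : R) : Prop :=
  exists (a b : T) (alpha beta : R[i]),
    [/\ a != b,
        `|alpha| = ((Num.sqrt 2)^-1)%:C,
        `|beta| = ((Num.sqrt 2)^-1)%:C &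
        transition_mx e tau *m vertex_vec R[i] a =
          alpha *: vertex_vec R[i] a + beta *: vertex_vec R[i] b].

Definition connected_graph (T : finType) (e : rel T) : Prop :=
  forall x y : T, connect e x y.

Definition hamming_dist (n : nat) (x y : n.-tuple bool) : nat :=
  #|[set i : 'I_n | tnth x i != tnth y i]|.

Definition hamming_graph (n r : nat) : rel (n.-tuple bool) :=
  fun x y => hamming_dist x y == r.

Definition bdigit (m j : nat) : bool := odd (m %/ 2 ^ j).

(* The digits of r' are those of m after: keeping the positions up to
   logn 2 m; turning one "10", at positions j.+1 and j, into "01"; and turning
   some of the 1s at all other positions into 0s.  The last clause forbids
   turning a 0 into a 1 there, so that only one "10" is replaced. *)
Definition digits_obtained (m r' : nat) : Prop :=
  (forall i, (i <= logn 2 m)%N -> bdigit r' i = bdigit m i) /\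
  exists j : nat,
    [/\ (logn 2 m < j)%N,
        bdigit m j.+1 /\ ~~ bdigit m j,
        ~~ bdigit r' j.+1 /\ bdigit r' j &
        forall i, (logn 2 m < i)%N -> i != j -> i != j.+1 ->
          bdigit r' i -> bdigit m i].

(* Main.v *)
Require Import Defs.
From mathcomp Require Import boolp classical_sets reals topology normedtype.
From mathcomp Require Import all_boot all_order all_algebra complex zify ring.
From mathcomp Require Import sequences trigo.

(** With [m = n - 1] and [q = r - 1]: the characters of (Z/2)^n diagonalise the
adjacency matrix, the eigenvalue at a word of weight [w] being the Krawtchouk
number [K_r(w)], the coefficient of [X^r] in [(1 - X)^w (1 + X)^(n - w)].
By Fourier inversion, revival from [a] to [b] means that
[exp(- i tau K_r(|s|)) = alpha + beta chi_s(a + b)] for every word [s]; the left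
side depends only on the weight of [s], which forces [a + b] to be the all-ones
word.  At [tau = pi / 8], as [exp(- i pi / 8)] is a primitive 16th root of unity,
balanced revival amounts to [K_r(0) - K_r(1) = 4 mod 8] and
[K_r(w) = K_r(w + 2) mod 16].  Factoring [2 X], resp. [4 X], out of the
generating functions turns this into [v_2(C(m, q)) = 1], [4 | C(m - 1, q)] and
[2 | C(m - 2, q - 1)].  Connectedness forces [q] even; then
[m C(m - 1, q) = (m - q) C(m, q)] shows that [m] is even and that [m] and [q]
agree up to the lowest 1 of [m], while [v_2(C(m, q)) = 1] says that exactly one
borrow occurs in [m - q], that is, one "10" of [m] is turned into "01". *)

Set Implicit Arguments.
Unset Strict Implicit.
Unset Printing Implicit Defensive.

Import Order.TTheory GRing.Theory Num.Theory.
Import numFieldNormedType.Exports.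

(** * Binary digits and 2-adic valuations of binomial coefficients *)

Lemma bdigit0 m : bdigit m 0 = odd m.
Proof. by rewrite /bdigit expn0 divn1. Qed.

Lemma bdigitS m j : bdigit m j.+1 = bdigit m./2 j.
Proof. by rewrite /bdigit expnS divnMA divn2. Qed.

Definition digits_below (q m : nat) : Prop :=
  forall i, bdigit q i -> bdigit m i.

(** The digit pattern of a subtraction [m - q] with exactly one borrow: the borrow arises at [j],
    where a 1 is taken from a 0, and is absorbed at [j.+1], where [m] has a spare 1. *)
Definition one_borrow (q m : nat) : Prop :=
  exists j, [/\ bdigit m j.+1 /\ ~~ bdigit m j, ~~ bdigit q j.+1 /\ bdigit q j &
    forall i, i != j -> i != j.+1 -> bdigit q i -> bdigit m i].

Lemma digits_belowE q m :
  digits_below q m <-> (odd q -> odd m) /\ digits_below q./2 m./2.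
Proof.
split=> [h|[h0 h] [|i]]; last 2 first.
- by rewrite !bdigit0.
- by rewrite !bdigitS; exact: h.
by split=> [|i]; [move: (h 0); rewrite !bdigit0 | rewrite -!bdigitS; exact: h].
Qed.

(** Recursion on the lowest digit: the borrow either lies in the halves, or arises at position 0 and
    is settled at position 1. *)
Lemma one_borrowE q m :
  one_borrow q m <->
  ((odd q -> odd m) /\ one_borrow q./2 m./2) \/
  [/\ odd q, ~~ odd m, odd m./2, ~~ odd q./2 & digits_below q./2./2 m./2./2].
Proof.
split=> [[[|j] [m1 q1 h]]|].
- move: m1 q1; rewrite !bdigitS !bdigit0 => -[m1 m0] [q1 q0].
  by right; split=> // i; move: (h i.+2); rewrite !bdigitS; apply.
- left; split; first by move: (h 0); rewrite !bdigit0; apply.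
  by exists j; split=> [||i ij ij1]; rewrite -!bdigitS //; apply: h.
move=> [[h0 [j [m1 q1 h]]]|[q0 m0 m1 q1 h]].
  exists j.+1; split.
  - by rewrite (bdigitS m j.+1) (bdigitS m j).
  - by rewrite (bdigitS q j.+1) (bdigitS q j).
  - by move=> [|i]; [rewrite !bdigit0 | rewrite !(bdigitS _ i); exact: h].
exists 0; rewrite !bdigitS !bdigit0; split=> // -[|[|i]] // _ _.
by rewrite !bdigitS; exact: h.
Qed.

Lemma logn2_odd m : odd m -> logn 2 m = 0.
Proof. by move=> om; apply: logn_coprime; rewrite coprime2n. Qed.

Lemma logn2_double m : 0 < m -> logn 2 m.*2 = (logn 2 m).+1.
Proof. by move=> m0; rewrite -mul2n lognM. Qed.

(** One step of Legendre's formula: odd factors contribute nothing, and halving the even ones leaves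
    the factorial of [m./2]. *)
Lemma logn2_fact_half m : logn 2 m`! = m./2 + logn 2 (m./2)`!.
Proof.
have H k : logn 2 (k.*2)`! = k + logn 2 k`!.
  elim: k => // k IH.
  rewrite doubleS 3!factS !lognM ?muln_gt0 ?fact_gt0 // -doubleS logn2_double //.
  by rewrite (@logn2_odd k.*2.+1) ?oddS ?odd_double // IH; lia.
rewrite -[in LHS](odd_double_half m); case: (boolP (odd m)) => om /=; last exact: H.
by rewrite add1n factS lognM ?fact_gt0 // H logn2_odd //= odd_double.
Qed.

(** Without a borrow at the lowest digit, halving commutes with [m - q], so the linear terms of
    Legendre's formula cancel. *)
Lemma logn2_bin_half m q : q <= m -> (odd q -> odd m) ->
  logn 2 'C(m, q) = logn 2 'C(m./2, q./2).
Proof.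
move=> qm oqm; have qm2 : q./2 <= m./2 by lia.
have := congr1 (logn 2) (bin_fact qm); have := congr1 (logn 2) (bin_fact qm2).
rewrite !lognM ?muln_gt0 ?fact_gt0 ?bin_gt0 //.
rewrite (logn2_fact_half m) (logn2_fact_half q) (logn2_fact_half (m - q)).
have -> : (m - q)./2 = m./2 - q./2 by lia.
lia.
Qed.

(** With a borrow, q C(m, q) = m C(m - 1, q - 1) moves to an odd upper index, where halving applies
    again. *)
Lemma logn2_bin_borrow m q : q <= m -> odd q -> ~~ odd m ->
  logn 2 'C(m, q) = (logn 2 m./2 + logn 2 'C(m./2.-1, q./2)).+1.
Proof.
case: q => // q qm oq om.
have := congr1 (logn 2) (mul_bin_diag m q).
rewrite !lognM ?bin_gt0 //; try lia.
have mE : m = (m./2).*2 by lia.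
rewrite (logn2_odd oq) {1}mE logn2_double; last lia.
rewrite (@logn2_bin_half m.-1 q); [|lia..].
have -> : m.-1./2 = m./2.-1 by lia.
have -> : q.+1./2 = q./2 by lia.
lia.
Qed.

(** The case of no borrow in Kummer's theorem, by descent on halves; a borrow at the lowest digit
    already makes the valuation positive. *)
Lemma logn2_bin_eq0 m q : q <= m ->
  (logn 2 'C(m, q) = 0 <-> digits_below q m).
Proof.
elim/ltn_ind: m q => -[|m] IH q qm.
  have -> : q = 0 by lia.
  by rewrite bin0 logn1; split=> [_ i|].
rewrite digits_belowE; case: (boolP (odd q && ~~ odd m.+1)) => [/andP[oq om]|o].
  by rewrite logn2_bin_borrow //; split=> // -[/(_ oq) h]; move: om; rewrite h.
rewrite logn2_bin_half //; last by move: o; do 2 case: odd.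
by rewrite IH; [move: o; do 2 case: odd => //=; tauto|lia..].
Qed.

(** The case of one borrow in Kummer's theorem. A borrow at the lowest digit must be the only one,
    which hands the remaining digits over to [logn2_bin_eq0]. *)
Lemma logn2_bin_eq1 m q : q <= m ->
  (logn 2 'C(m, q) = 1 <-> one_borrow q m).
Proof.
elim/ltn_ind: m q => m IH q qm; case: (posnP m) => [m0|m_gt0].
  have -> : q = 0 by lia.
  rewrite m0.
  by rewrite bin0 logn1; split=> [|[j [_ []]]]; rewrite /bdigit ?div0n.
rewrite one_borrowE; case: (boolP (odd q && ~~ odd m)) => [/andP[oq om]|o].
  rewrite logn2_bin_borrow //.
  have m2_gt0 : 0 < m./2 by lia.
  split=> [[] /eqP|[[h0 _]|[_ _ om2 oq2 h]]].
  (* Both summands vanish: [m./2] is odd, so its predecessor only loses the lowest 1, and [q./2]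
     below it must be even. *)
  - rewrite addn_eq0 => /andP[/eqP l0 /eqP /logn2_bin_eq0].
    move=> /(_ ltac:(lia)) h.
    have om2 : odd m./2.
      apply: contraTT isT => e; move: l0.
      by have -> : m./2 = (m./2./2).*2; [lia | rewrite logn2_double //; lia].
    have [h0 h1] := (digits_belowE _ _).1 h; right; split=> //.
      by apply/negP => /h0; lia.
    by have <- : m./2.-1./2 = m./2./2; [lia |].
  - by rewrite h0 in om.
  - rewrite logn2_odd // (logn2_bin_eq0 _).2 //; first lia.
    rewrite digits_belowE (negbTE oq2); split=> //.
    by have -> : m./2.-1./2 = m./2./2; [lia |].
rewrite logn2_bin_half //; last by move: o; do 2 case: odd.
rewrite IH; [|lia..].
split=> [h|[[]//|[oq om]]]; last by rewrite oq om in o.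
by left; split=> //; move: o; do 2 case: odd.
Qed.

(** * The digit conditions expressed by valuations *)

Lemma bdigit_eq_modn q m v :
  (forall i, i < v -> bdigit q i = bdigit m i) <-> q = m %[mod 2 ^ v].
Proof.
elim: v q m => [|v IH] q m; first by rewrite !modn1.
have E k : k %% 2 ^ v.+1 = (k./2 %% 2 ^ v).*2 + odd k.
  rewrite -divn2 modn_divl -expnSr divn2.
  rewrite -[LHS]odd_double_half addnC odd_mod ?oddX //.
split=> [h|].
  rewrite !E; have := h 0 isT; rewrite !bdigit0 => ->.
  congr (_.*2 + _); apply/(IH q./2 m./2) => i iv.
  by rewrite -!bdigitS; exact: h.
rewrite !E => h [|i]; first by rewrite !bdigit0; lia.
have /IH h2 : q./2 = m./2 %[mod 2 ^ v] by lia.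
by rewrite ltnS !bdigitS; exact: h2.
Qed.

(** The excluded numbers are a block of [b] ones followed by [a] zeros, so they show no [10] above
    their lowest 1. *)
Lemma bdigit_pow2_mul_pred a b j :
  bdigit (2 ^ a * (2 ^ b - 1)) j = (a <= j < a + b).
Proof.
elim: a j => [|a IH] j; last first.
  rewrite expnS -mulnA mul2n; case: j => [|j]; first by rewrite bdigit0 odd_double.
  by rewrite bdigitS doubleK IH.
rewrite mul1n; elim: b j => [|b IH] j; first by rewrite /bdigit div0n ltn0.
have b0 : 0 < 2 ^ b by rewrite expn_gt0.
case: j => [|j]; first by rewrite bdigit0 expnS; lia.
rewrite bdigitS; have -> : (2 ^ b.+1 - 1)./2 = 2 ^ b - 1 by rewrite expnS; lia.
by have := IH j; rewrite !add0n.
Qed.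

(** Keeping the low digits is a congruence modulo a power of 2. Since the digits agree there, the
    single borrow can only sit above [logn 2 m]. *)
Lemma digits_obtainedE m q : 0 < m -> q <= m ->
  digits_obtained m q <->
  2 ^ (logn 2 m).+1 %| m - q /\ logn 2 'C(m, q) = 1.
Proof.
move=> m0 qm.
have E : (2 ^ (logn 2 m).+1 %| m - q) <->
    forall i, i <= logn 2 m -> bdigit q i = bdigit m i.
  rewrite -eqn_mod_dvd // eq_sym; split=> [/eqP /bdigit_eq_modn //|h].
  by apply/eqP/bdigit_eq_modn.
split=> [[low [j [jv [m1 /negP m0j] [q1 q0] h]]]|[/E low /(logn2_bin_eq1 qm)]].
  split; first exact/E.
  apply/(logn2_bin_eq1 qm); exists j; split=> //; first by split=> //; apply/negP.
  move=> i ij ij1; case: (leqP i (logn 2 m)) => [/low -> //|iv]; exact: h.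
move=> [j [m1 q1 h]]; split=> //; exists j; split=> //.
  by rewrite ltnNge; apply/negP => /low; move: m1 q1 => [_ /negbTE ->] [_ ->].
by move=> i _; exact: h.
Qed.

Lemma binomial_condition n r : 0 < r <= n ->
  (~~ odd r.-1 /\ [/\ logn 2 'C(n.-1, r.-1) = 1,
    4 %| 'C(n.-1.-1, r.-1) & 2 %| 'C(n.-1.-2, r.-1.-1)]) <->
  ((odd n /\ forall a b : nat, n.-1 <> 2 ^ a * (2 ^ b - 1)) /\
   digits_obtained n.-1 r.-1).
Proof.
case: n r => [|m] [|q] //=; rewrite ltnS => qm.
have lg k l : 0 < l -> (2 ^ k %| l) = (k <= logn 2 l) by move=> ?; exact: pfactor_dvdn.
split=> [[oq [l1 d4 d2]]|[[om ab] D]].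
  have q0 : 0 < q by case: q {qm d2} l1 d4 oq => //; rewrite bin0 logn1.
  have qltm : q < m.
    by rewrite ltn_neqAle qm andbT; apply/eqP => e; move: l1; rewrite e binn logn1.
  have C2 : 2 <= logn 2 'C(m.-1, q) by rewrite -lg // bin_gt0; lia.
  (* This yields v_2(m) + v_2(C(m - 1, q)) = v_2(m - q) + 1, hence v_2(m - q) > v_2(m). *)
  have := congr1 (logn 2) (mul_bin_down m q).
  rewrite !lognM ?bin_gt0 ?l1 //; try lia; move=> L.
  have em : ~~ odd m.
    apply/negP => om; have := @logn2_odd (m - q).
    by rewrite oddB // om (negbTE oq) => /(_ isT); lia.
  have D : digits_obtained m q.
    by apply/digits_obtainedE => //; [lia|rewrite lg; [split=> //|]; lia].
  (* Here [a] is at most [logn 2 m], hence below [j]; a 0 at [j] then lies above the block of ones,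
     which contradicts the 1 at [j.+1]. *)
  split=> //; split=> // a b; case: D => _ [j [jv [m1 /negP m0] _ _]] E.
  move: m0 m1 jv; rewrite E !bdigit_pow2_mul_pred.
  rewrite lognM ?expn_gt0 //; last by case: b E => [|b] E; [lia|]; rewrite subn_gt0 -{1}(expn0 2) ltn_exp2l.
  by rewrite pfactorK //; lia.
(* The excluded form with a = b = 0 is the number 0. *)
have m0 : 0 < m by case: (posnP m) => // m0; case: (ab 0 0).
have em : ~~ odd m by [].
have v0 : 0 < logn 2 m by rewrite -lg // dvdn2.
move/digits_obtainedE: D => /(_ m0 qm) [dv l1].
have oq : ~~ odd q.
  have : 2 %| m - q by apply: dvdn_trans dv; exact: (@dvdn_exp2l 2 1).
  by rewrite dvdn2; lia.
split=> //; split=> //.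
  have q0 : 0 < q by case: q {qm dv oq} l1 => //; rewrite bin0 logn1.
  have qltm : q < m.
    by rewrite ltn_neqAle qm andbT; apply/eqP => e; move: l1; rewrite e binn logn1.
  rewrite (lg 2); last by rewrite bin_gt0; lia.
  have := congr1 (logn 2) (mul_bin_down m q).
  rewrite !lognM ?bin_gt0 ?l1 //; try lia.
  by move: dv; rewrite lg; lia.
(* The last divisibility is (q - 1) C(m - 2, q - 1) = (m - 2) C(m - 3, q - 2) read modulo 2, with
   [m] and [q] even. *)
case: q oq l1 {qm dv} => [|[|q]] //=; rewrite ?bin0 ?logn1 //= negbK => oq _.
rewrite dvdn2; have := congr1 odd (mul_bin_diag m.-2 q).
rewrite !oddM /= oq /= => <-.
have -> : odd m.-2 = false by lia.
by [].
Qed.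

Local Open Scope ring_scope.

(** * Krawtchouk numbers *)

Definition krawtchouk (n k w : nat) : int :=
  ((1 - 'X) ^+ w * (1 + 'X) ^+ (n - w) : {poly int})`_k.

(** After removing the common factor, (1 + X) - (1 - X) = 2 X remains; the X shifts the degree by
    one. *)
Lemma krawtchouk_sub n k w : (w <= n)%N ->
  krawtchouk n.+1 k.+1 w - krawtchouk n.+1 k.+1 w.+1 = 2 * krawtchouk n k w.
Proof.
move=> wn; rewrite /krawtchouk subSS (subSn wn) -coefB !exprS.
have -> : (1 - 'X) ^+ w * ((1 + 'X) * (1 + 'X) ^+ (n - w)) -
    (1 - 'X) * (1 - 'X) ^+ w * (1 + 'X) ^+ (n - w) =
    ((1 - 'X) ^+ w * (1 + 'X) ^+ (n - w)) * 'X *+ 2 :> {poly int}.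
  by ring.
by rewrite coefMn coefMX /= mulr_natl.
Qed.

Lemma krawtchouk_sub2 n k w : (w <= n)%N ->
  krawtchouk n.+2 k.+1 w - krawtchouk n.+2 k.+1 w.+2 = 4 * krawtchouk n k w.
Proof.
move=> wn; rewrite /krawtchouk !subSS (@subSn w n.+1) ?(@subSn w n) //; last by lia.
rewrite -coefB !exprS.
have -> : (1 - 'X) ^+ w * ((1 + 'X) * ((1 + 'X) * (1 + 'X) ^+ (n - w))) -
    (1 - 'X) * ((1 - 'X) * (1 - 'X) ^+ w) * (1 + 'X) ^+ (n - w) =
    ((1 - 'X) ^+ w * (1 + 'X) ^+ (n - w)) * 'X *+ 4 :> {poly int}.
  by ring.
by rewrite coefMn coefMX /= mulr_natl.
Qed.

Lemma krawtchouk0 n k : krawtchouk n k 0 = 'C(n, k).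
Proof.
rewrite /krawtchouk expr0 mul1r subn0 exprDn coef_sum.
under eq_bigr => i _ do rewrite expr1n mul1r coefMn coefXn.
have [nk|kn] := ltnP n k.
  rewrite bin_small // big1 // => i _.
  by rewrite (_ : (k == i) = false) ?mul0rn //; apply/eqP; have := ltn_ord i; lia.
rewrite (bigD1 (Ordinal (kn : k < n.+1)%N)) //= eqxx natz big1 ?addr0 // => i ik.
by rewrite (_ : (k == i) = false) ?mul0rn //; apply: contraNF ik => /eqP e; apply/eqP/val_inj.
Qed.

Lemma krawtchouk0r n w : krawtchouk n 0 w = 1.
Proof.
by rewrite /krawtchouk coef0M -!horner_coef0 !hornerE; rewrite ?expr1n ?mulr1.
Qed.

(** Modulo 2 the factors 1 - X and 1 + X coincide, so the weight does not matter. *)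
Lemma krawtchouk_mod2 n k w : (w <= n)%N ->
  exists z, krawtchouk n k w = 'C(n, k)%:Z + 2 * z.
Proof.
elim: w n k => [|w IH] n k wn; first by exists 0; rewrite krawtchouk0 mulr0 addr0.
have [z] := IH n k (ltnW wn); case: k => [|k] zE; first by exists 0; rewrite krawtchouk0r bin0; lia.
case: n => [|n] in wn zE *; first by [].
exists (z - krawtchouk n k w); have := @krawtchouk_sub n k w wn.
lia.
Qed.

Lemma krawtchouk_cond n r : (0 < r <= n)%N ->
  (exists z, krawtchouk n r 0 - krawtchouk n r 1 = 4 + 8 * z) /\
  (forall w, (w.+2 <= n)%N -> exists z, krawtchouk n r w - krawtchouk n r w.+2 = 16 * z) <->
  [/\ logn 2 'C(n.-1, r.-1) = 1%N,
    (4 %| 'C(n.-1.-1, r.-1))%N & (2 %| 'C(n.-1.-2, r.-1.-1))%N].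
Proof.
case: n r => [|m] [|q] //=; rewrite ltnS => qm.
have C0 : (0 < 'C(m, q))%N by rewrite bin_gt0.
have lg : (logn 2 'C(m, q) == 1%N) = (2 %| 'C(m, q))%N && ~~ (4 %| 'C(m, q))%N.
  by rewrite (@pfactor_dvdn 2 1) // (@pfactor_dvdn 2 2) //; lia.
rewrite krawtchouk_sub // krawtchouk0.
have H1 : (exists z, 2 * 'C(m, q)%:Z = 4 + 8 * z) <-> logn 2 'C(m, q) = 1%N.
  split=> [[z h]|/eqP]; first by apply/eqP; rewrite lg; lia.
  (* Here C(m, q) = 2 k with [k] odd, so that 2 C(m, q) = 4 + 8 (k - 1) / 2. *)
  by rewrite lg => /andP[/dvdnP [k kE] n4]; exists (k./2%:Z); lia.
have main : logn 2 'C(m, q) = 1%N ->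
  (forall w, (w < m)%N -> exists z, krawtchouk m.+1 q.+1 w - krawtchouk m.+1 q.+1 w.+2 = 16 * z)
  <-> (4 %| 'C(m.-1, q))%N /\ (2 %| 'C(m.-2, q.-1))%N.
  move=> l1.
  (* At q = 0 and q = m the binomial is 1, against its valuation; this leaves [m] at least 2, so
     weights 0 and 1 are both available below. *)
  have q0 : (0 < q)%N by case: q {qm C0 lg H1} l1 => //; rewrite bin0 logn1.
  have qltm : (q < m)%N.
    by rewrite ltn_neqAle qm andbT; apply/eqP => e; move: l1; rewrite e binn logn1.
  case: q {C0 lg H1 l1 qm} q0 qltm => // q _; case: m => // -[|m] // qm /=.
  split=> [H|[/dvdnP [k4 d4] /dvdnP [k2 d2]] w wm].
    have [z0 z0E] := H 0%N isT; have [z1 z1E] := H 1%N isT.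
    rewrite !krawtchouk_sub2 // krawtchouk0 in z0E z1E.
    have := @krawtchouk_sub m q 0 isT; rewrite !krawtchouk0 => S.
    by lia.
  rewrite krawtchouk_sub2; last lia.
  (* By induction on the weight: consecutive values differ by twice a Krawtchouk number that has the
     parity of C(m, q), hence by a multiple of 4. *)
  suff [z ->] : exists z, krawtchouk m.+1 q.+1 w = 4 * z by exists z; lia.
  elim: w wm => [|w IH] wm; first by exists k4%:Z; rewrite krawtchouk0; lia.
  have [z zE] := IH (ltnW wm).
  have := @krawtchouk_sub m q w ltac:(lia).
  have [y yE] := @krawtchouk_mod2 m q w ltac:(lia).
  by exists (z - k2%:Z - y); lia.
split=> [[/H1 l1 /(main l1) [? ?]] //|[l1 d4 d2]].
by split; [apply/H1|apply/main].
Qed.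

Local Close Scope ring_scope.

(** * Binary words, connectedness and characters *)

Section Words.
Variable n : nat.
Implicit Types (x y z s t : n.-tuple bool) (S : {set 'I_n}).

Definition weight x : nat := \sum_i tnth x i.

Definition xort x y : n.-tuple bool := [tuple tnth x i (+) tnth y i | i < n].

Definition ind S : n.-tuple bool := [tuple i \in S | i < n].

Lemma neq_tnth x y : x != y -> exists i, tnth x i != tnth y i.
Proof.
move=> xy; apply/existsP; rewrite -negb_forall; apply: contra xy => /forallP h.
by apply/eqP/eq_from_tnth => i; apply/eqP/h.
Qed.

Lemma xortA x y z : xort x (xort y z) = xort (xort x y) z.
Proof. by apply: eq_from_tnth => i; rewrite !tnth_mktuple addbA. Qed.

Lemma xortK x y : xort x (xort x y) = y.
Proof. by apply: eq_from_tnth => i; rewrite !tnth_mktuple addKb. Qed.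

Lemma weight_ind S : weight (ind S) = #|S|.
Proof.
rewrite /weight -sum1_card [RHS]big_mkcond /=; apply: eq_bigr => i _.
by rewrite tnth_mktuple; case: (i \in S).
Qed.

Lemma ind_surj x : x = ind [set i | tnth x i].
Proof. by apply: eq_from_tnth => i; rewrite tnth_mktuple inE. Qed.

Lemma hamming_distE x y : hamming_dist x y = weight (xort x y).
Proof.
rewrite /hamming_dist /weight -sum1_card [LHS]big_mkcond /=; apply: eq_bigr => i _.
(* The set counted by [hamming_dist] is a classical set, so membership is unfolded by [in_setE]. *)
rewrite tnth_mktuple (_ : _ \in _ = (tnth x i != tnth y i)); last first.
  by apply/idP/idP; rewrite classical_sets.in_setE.
by case: (tnth x i) (tnth y i) => -[].
Qed.

Lemma odd_weight_xort x y : odd (weight (xort x y)) = odd (weight x) (+) odd (weight y).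
Proof.
rewrite /weight !(big_morph odd oddD (erefl _)) -big_split /=.
by apply: eq_bigr => i _; rewrite tnth_mktuple !oddb.
Qed.

Lemma exists_subset_card (A : {set 'I_n}) k : (k <= #|A|)%N ->
  exists2 S : {set 'I_n}, S \subset A & #|S| = k.
Proof.
move=> kA; exists [set x in take k (enum A)].
  by apply/subsetP => x; rewrite inE => /mem_take; rewrite mem_enum.
by rewrite cardsE (card_uniqP (take_uniq _ (enum_uniq _))) size_takel // -cardE.
Qed.

Lemma hamming_graph_xort r x y : hamming_graph r x (xort x y) = (weight y == r).
Proof. by rewrite /hamming_graph hamming_distE xortK. Qed.

(** For even [r] every edge preserves the parity of the weight, which separates the zero word from a
    word of weight 1. *)
Lemma connected_odd r : (0 < n)%N -> connected_graph (@hamming_graph n r) -> odd r.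
Proof.
move=> n0 /(_ (ind set0) (ind [set Ordinal n0])); apply: contraTT => er.
have cl : closed (@hamming_graph n r) [pred x | odd (weight x)].
  move=> x y /eqP; rewrite hamming_distE !inE => h.
  by have := odd_weight_xort x y; rewrite h (negbTE er); do 2 case: odd.
apply/negP => /(closed_connect cl).
by rewrite !inE !weight_ind cards0 cards1.
Qed.

(** Two steps flip any two positions [i] and [j]: flip [i |: S], then [j |: S], with r - 1 positions
    in [S]. The bound r < n leaves room for [S], and an even word is a sum of disjoint pairs. *)
Lemma connect_even r : (0 < r < n)%N -> forall x y, ~~ odd (weight y) ->
  connect (@hamming_graph n r) x (xort x y).
Proof.
move=> /andP[r0 rn].
have pair x i j : i != j -> connect (@hamming_graph n r) x (xort x (ind [set i; j])).
  move=> ij.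
  have [|S Sij cS] := @exists_subset_card (~: [set i; j]) r.-1.
    by have := cardsC [set i; j]; rewrite cards2 ij card_ord; lia.
  have iS : i \notin S by apply/negP => /(subsetP Sij); rewrite !inE eqxx.
  have jS : j \notin S by apply/negP => /(subsetP Sij); rewrite !inE eqxx orbT.
  have E : ind [set i; j] = xort (ind (i |: S)) (ind (j |: S)).
    apply: eq_from_tnth => k; rewrite !tnth_mktuple !inE.
    have [->|ki] := eqVneq k i; first by rewrite (negbTE ij) (negbTE iS).
    have [->|kj] := eqVneq k j; first by rewrite (negbTE jS).
    by rewrite /= addbb.
  rewrite E xortA; apply: (@connect_trans _ _ (xort x (ind (i |: S)))); apply: connect1; rewrite hamming_graph_xort weight_ind.
    by rewrite cardsU1 iS cS; lia.
  by rewrite cardsU1 jS cS; lia.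
move=> x y; rewrite (ind_surj y) weight_ind; move: [set i | _] => {y} S.
have [k] := ubnP #|S|; elim: k S x => // k IH S x Sk Se.
have [->|[i iS]] := set_0Vmem S.
  have -> : xort x (ind set0) = x; last exact: connect0.
  by apply: eq_from_tnth => i; rewrite !tnth_mktuple inE addbF.
have cS : #|S| = #|S :\ i|.+1 by rewrite (cardsD1 i) iS.
have [Sd0|[j]] := set_0Vmem (S :\ i); first by move: Se; rewrite cS Sd0 cards0.
move=> jS; have cS2 : #|S :\ i| = #|S :\ i :\ j|.+1 by rewrite (cardsD1 j) jS.
move: jS; rewrite !inE => /andP[ji jS].
have E : ind S = xort (ind [set i; j]) (ind (S :\ i :\ j)).
  apply: eq_from_tnth => k'; rewrite !tnth_mktuple !inE.
  have [->|_] := eqVneq k' i; first by rewrite iS andbF.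
  by have [->|_] := eqVneq k' j; rewrite ?jS.
rewrite E xortA; apply: connect_trans (pair _ _ _ _) (IH _ _ _ _).
- by rewrite eq_sym.
- by move: Sk; rewrite cS cS2; lia.
- by move: Se; rewrite cS cS2 /= negbK.
Qed.

(** A single step of odd size turns an odd displacement into an even one. *)
Lemma odd_connected r : (0 < r < n)%N -> odd r -> connected_graph (@hamming_graph n r).
Proof.
move=> hr ro x y.
have [|S _ cS] := @exists_subset_card setT r; first by rewrite cardsT card_ord; lia.
rewrite -[y](xortK x); set d := xort x y.
have [od|ed] := boolP (odd (weight d)); last exact: connect_even.
rewrite -[d](xortK (ind S)) xortA.
apply: connect_trans (connect_even _ _ _) => //.
  by apply: connect1; rewrite hamming_graph_xort weight_ind cS.
by rewrite odd_weight_xort od weight_ind cS ro.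
Qed.

(** * Characters of the group of words and their sums *)

Local Open Scope ring_scope.

(** The values stay in [int], as do the Krawtchouk numbers, and are cast to complex numbers only in
    the spectral part. *)
Definition chi s x : int := \prod_i (-1) ^+ (tnth s i && tnth x i).

Lemma chiC s x : chi s x = chi x s.
Proof. by apply: eq_bigr => i _; rewrite andbC. Qed.

Lemma chi_xort s x y : chi s (xort x y) = chi s x * chi s y.
Proof.
rewrite -big_split /=; apply: eq_bigr => i _; rewrite tnth_mktuple.
by case: (tnth s i) (tnth x i) (tnth y i) => -[] [].
Qed.

Lemma chi_sqr s x : chi s x * chi s x = 1.
Proof.
rewrite -big_split big1 // => i _ /=.
by case: (tnth s i && tnth x i).
Qed.

Lemma sum_words (K : comPzRingType) (F : 'I_n -> bool -> K) :
  \sum_(x : n.-tuple bool) \prod_i F i (tnth x i) = \prod_i (F i true + F i false).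
Proof.
under [RHS]eq_bigr => i _ do rewrite -big_bool.
rewrite bigA_distr_bigA (reindex (fun f : {ffun 'I_n -> bool} => [tuple f i | i < n])) /=.
  by apply: eq_bigr => f _; apply: eq_bigr => i _; rewrite tnth_mktuple.
exists (fun x => [ffun i => tnth x i]) => [f _|x _].
  by apply/ffunP => i; rewrite ffunE tnth_mktuple.
by apply: eq_from_tnth => i; rewrite tnth_mktuple ffunE.
Qed.

(** The sum factors over the coordinates, and a coordinate where [x] and [y] differ contributes 1 -
    1 = 0. *)
Lemma chi_orthogonal x y :
  \sum_s chi s x * chi s y = (2 ^ n)%:Z * (x == y).
Proof.
under eq_bigr => s _ do rewrite -chi_xort.
rewrite /chi (sum_words (fun i b => (-1) ^+ (b && tnth (xort x y) i))) /=.
have [<-|xy] := eqVneq x y.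
  rewrite (eq_bigr (fun=> 2)) => [|i _]; last by rewrite tnth_mktuple addbb.
  by rewrite prodr_const card_ord mulr1 -natz natrX.
have [i /eqP hi] := neq_tnth xy.
rewrite (bigD1 i) //= tnth_mktuple; move: hi.
by case: (tnth x i) (tnth y i) => -[] //= _; rewrite mul0r mulr0.
Qed.

(** The product of the factors 1 + (-1)^(s_i) X is computed twice: grouping by s_i gives the
    Krawtchouk generating function, expanding over words [z] gives the sum of chi_s(z) X^|z|. *)
Lemma sum_sphere_chi r s :
  \sum_(z | weight z == r) chi s z = krawtchouk n r (weight s).
Proof.
have key : \prod_i (1 + (-1) ^+ tnth s i * 'X) =
    (1 - 'X) ^+ weight s * (1 + 'X) ^+ (n - weight s) :> {poly int}.
  rewrite (bigID (tnth s)) /=; congr (_ * _).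
    rewrite (eq_bigr (fun=> 1 - 'X)) => [|i ->]; last by rewrite expr1 mulN1r.
    rewrite prodr_const; congr (_ ^+ _).
    rewrite -sum1_card big_mkcond /weight; apply: eq_bigr => i _.
    by rewrite unfold_in -/(tnth s i); case: (tnth s i).
  rewrite (eq_bigr (fun=> 1 + 'X)) => [|i /negbTE ->]; last by rewrite expr0 mul1r.
  rewrite prodr_const; congr (_ ^+ _).
  have : (n = #|[pred i | ~~ tnth s i]| + weight s)%N.
    rewrite -[LHS]card_ord -!sum1_card [X in (X + _)%N]big_mkcond -big_split /=.
    by apply: eq_bigr => i _; rewrite unfold_in /= -/(tnth s i); case: (tnth s i).
  by move=> /(congr1 (subn^~ (weight s))) /=; rewrite addnK; exact: esym.
rewrite /krawtchouk -key.
under eq_bigr => i _ do rewrite addrC.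
rewrite -(sum_words (fun i b => if b then (-1) ^+ tnth s i * 'X else 1)) coef_sum.
rewrite big_mkcond; apply: eq_bigr => z _.
have -> : \prod_i (if tnth z i then (-1) ^+ tnth s i * 'X else 1) =
    (chi s z)%:P * 'X^(weight z) :> {poly int}.
  rewrite rmorph_prod /weight -prodrXr -big_split /=; apply: eq_bigr => i _.
  by case: (tnth z i); rewrite ?andbT ?andbF ?rmorphXn ?rmorphN1 //= ?mulr1.
by rewrite coefCM coefXn eq_sym; case: eqP; rewrite ?mulr1 ?mulr0.
Qed.

(** The neighbours of [x] are the sums x + z with |z| = r, so multiplicativity makes each character
    an eigenvector. *)
Lemma sum_adjacent_chi r s x :
  \sum_y (hamming_graph r x y)%:R * chi s y = krawtchouk n r (weight s) * chi s x.
Proof.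
rewrite -sum_sphere_chi mulr_suml (reindex (xort x)) /=; last first.
  by exists (xort x) => y _; exact: xortK.
rewrite [RHS]big_mkcond; apply: eq_bigr => y _.
rewrite hamming_graph_xort chi_xort; case: ifP => _; last by rewrite mul0r.
by rewrite mul1r mulrC.
Qed.

End Words.

Local Open Scope ring_scope.
Local Open Scope complex_scope.

(** * Spectral decomposition of the transition matrix *)

Section Exponential.
Local Open Scope classical_set_scope.
Variable R : realType.

(** This is exp(- i t); the sign is that of the transition matrix. *)
Definition cexp (t : R) : R[i] := Complex (cos t) (- sin t).

Lemma cexpD s t : cexp (s + t) = cexp s * cexp t.
Proof. by apply/eqP; rewrite eq_complex /= cosD sinD; apply/andP; split; apply/eqP; ring. Qed.

Lemma cexp0 : cexp 0 = 1.
Proof. by rewrite /cexp cos0 sin0 oppr0. Qed.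

Lemma cvg_real_complex (u : nat -> R) (l : R) :
  u @ \oo --> l -> (fun N => (u N)%:C : R[i]^o) @ \oo --> (l%:C : R[i]^o).
Proof.
move=> /cvgrPdist_lt ul; apply/cvgrPdist_lt => e e0.
(* In the partial order of [R[i]], a positive element is real. *)
have [d d0 ->] : exists2 d : R, 0 < d & e = d%:C.
  by move: e0; case: e => a b; rewrite ltcE /= => /andP[/eqP -> ?]; exists a.
near=> N; rewrite -rmorphB /= normc_def /= expr0n addr0 sqrtr_sqr ltcR.
by near: N; exact: ul.
Unshelve. all: by end_near. Qed.

Lemma cexp_series (t : R) :
  (fun N => \sum_(0 <= k < N) (k`!%:R)^-1 * (- ('i%C * t%:C)) ^+ k : R[i]^o) @ \oo
    --> (cexp t : R[i]^o).
Proof.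
have E N : \sum_(0 <= k < N) (k`!%:R)^-1 * (- ('i%C * t%:C)) ^+ k =
    (series (cos_coeff t) N)%:C - 'i%C * (series (sin_coeff t) N)%:C :> R[i].
  rewrite /series /= !rmorph_sum mulr_sumr -sumrB; apply: eq_bigr => k _.
  have -> : k`!%:R = (k`!%:R)%:C :> R[i] by rewrite rmorph_nat.
  rewrite exprNn exprMn -rmorphXn /cos_coeff /sin_coeff -fmorphV /=.
  (* Splitting [k] by parity sends even terms to the cosine series and odd terms to the sine
     series. *)
  rewrite -[in 'i%C ^+ k](odd_double_half k) exprD -mul2n exprM sqr_i.
  rewrite -[in (-1) ^+ k](odd_double_half k) exprD -mul2n exprM sqrrN expr1n expr1n mulr1.
  have -> : (-1) ^ k./2 = (-1) ^+ k./2 :> R by [].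
  have [ok|ek] := boolP (odd k).
    have -> : k.-1./2 = k./2 by lia.
    by rewrite !mul0r !(rmorphM, rmorphXn, rmorphN1, rmorph1, rmorph0) /=; ring.
  by rewrite !mul0r !(rmorphM, rmorphXn, rmorphN1, rmorph1, rmorph0) /=; ring.
under eq_fun do rewrite E.
have -> : cexp t = (cos t)%:C - 'i%C * (sin t)%:C.
  by apply/eqP; rewrite eq_complex /=; apply/andP; split; apply/eqP; ring.
(* The cosine is defined as the limit of its series, so convergence already identifies the limit;
   likewise for the sine. *)
have H1 : (fun N => (series (cos_coeff t) N)%:C : R[i]^o) @ \oo --> ((cos t)%:C : R[i]^o).
  by apply: cvg_real_complex; rewrite unlock; exact: is_cvg_series_cos_coeff.
have H2 : (fun N => (series (sin_coeff t) N)%:C : R[i]^o) @ \oo --> ((sin t)%:C : R[i]^o).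
  by apply: cvg_real_complex; rewrite unlock; exact: is_cvg_series_sin_coeff.
exact: (cvgB H1 (cvgZr (k := 'i%C) H2)).
Qed.
End Exponential.

Section Transition.
Variables (R : realType) (n r : nat).
Local Notation word := (n.-tuple bool).
Local Notation lambda s := ((krawtchouk n r (weight s))%:~R : R[i]).
Local Notation chiR s x := ((chi s x)%:~R : R[i]).
Local Notation A := (adjmx R[i] (@hamming_graph n r)).

Lemma sum_enum_val (F : word -> R[i]) :
  \sum_(i < #|{: word}|) F (enum_val i) = \sum_x F x.
Proof. by rewrite [RHS](reindex _ (onW_bij _ (@enum_val_bij _))). Qed.

Lemma sum_chi_chi (x y : word) :
  \sum_s chiR s x * chiR s y = (2 ^ n)%:R * (x == y)%:R.
Proof.
under eq_bigr do rewrite -rmorphM.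
by rewrite -rmorph_sum chi_orthogonal rmorphM /= -!pmulrn.
Qed.

Lemma natr_pow2_neq0 : (2 ^ n)%:R != 0 :> R[i].
Proof. by rewrite pnatr_eq0 expn_eq0. Qed.

(** Spectral decomposition of the powers: orthogonality of characters gives k = 0, the eigenvector
    equation gives each further step. *)
Lemma adjmx_exp z k i j :
  ((z *: A) ^+ k) i j = ((2 ^ n)%:R)^-1 *
    \sum_s chiR s (enum_val i) * chiR s (enum_val j) * (z * lambda s) ^+ k.
Proof.
elim: k i j => [|k IH] i j.
  under eq_bigr do rewrite expr0 mulr1.
  rewrite sum_chi_chi mulrA mulVf ?natr_pow2_neq0 // mul1r expr0 mxE.
  by rewrite (inj_eq enum_val_inj).
rewrite exprS -mulmxE mxE; under eq_bigr do rewrite IH 2!mxE mulrCA mulr_sumr.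
rewrite -mulr_sumr exchange_big /=; congr (_ * _); apply: eq_bigr => s _.
have := congr1 (intmul (1 : R[i])) (sum_adjacent_chi r s (enum_val i)).
rewrite rmorph_sum rmorphM /= => E.
transitivity (\sum_l (hamming_graph r (enum_val i) l)%:R * chiR s l *
   (chiR s (enum_val j) * z * (z * lambda s) ^+ k)).
  rewrite -sum_enum_val; apply: eq_bigr => l _; ring.
have cast (b : bool) : b%:R = (b%:R : int)%:~R :> R[i] by case: b.
rewrite -mulr_suml; under eq_bigr do rewrite cast -rmorphM.
by rewrite E exprS; ring.
Qed.

Lemma transition_mxE (t : R) i j :
  transition_mx (@hamming_graph n r) t i j = ((2 ^ n)%:R)^-1 *
    \sum_s chiR s (enum_val i) * chiR s (enum_val j)
      * cexp (t * (krawtchouk n r (weight s))%:~R).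
Proof.
rewrite mxE; apply: (@cvg_lim R[i]^o); first exact: norm_hausdorff.
pose f N s : R[i]^o := chiR s (enum_val i) * chiR s (enum_val j) *
  \sum_(0 <= k < N) (k`!%:R)^-1 *
    (- ('i%C * (t * (krawtchouk n r (weight s))%:~R)%:C)) ^+ k.
have E N : (\sum_(0 <= k < N) (k`!%:R)^-1 *: (- ('i%C * t%:C) *: A) ^+ k) i j =
    ((2 ^ n)%:R)^-1 * \sum_s f N s.
  rewrite summxE; under eq_bigr do rewrite mxE adjmx_exp mulrCA mulr_sumr.
  rewrite -mulr_sumr exchange_big /=; congr (_ * _); apply: eq_bigr => s _.
  rewrite /f mulr_sumr; apply: eq_bigr => k _.
  rewrite mulrCA; congr (_ * (_ * _ ^+ _)).
  by rewrite rmorphM rmorph_int; ring.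
under eq_fun do rewrite E.
have H : ((fun N => \sum_s f N s) @ \oo -->
    (\sum_s chiR s (enum_val i) * chiR s (enum_val j)
      * cexp (t * (krawtchouk n r (weight s))%:~R) : R[i]^o))%classic.
  apply: cvg_big => [|s _]; first exact: add_continuous.
  exact: (cvgZr (k := chiR s (enum_val i) * chiR s (enum_val j)) (@cexp_series R _)).
exact: (cvgZr (k := ((2 ^ n)%:R)^-1) H).
Qed.

Lemma chiR_sqr (s x : word) : chiR s x * chiR s x = 1.
Proof. by rewrite -rmorphM chi_sqr. Qed.

Lemma chi_fourier (G : word -> R[i]) s0 :
  \sum_x chiR s0 x * (((2 ^ n)%:R)^-1 * \sum_s chiR s x * G s) = G s0.
Proof.
under eq_bigr do rewrite mulrCA mulr_sumr.
rewrite -mulr_sumr exchange_big /= (bigD1 s0) //= [X in _ + X]big1 => [|s ss0].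
  under eq_bigr do rewrite mulrA (chiC s0).
  by rewrite -mulr_suml sum_chi_chi eqxx mulr1 addr0 mulKf ?natr_pow2_neq0.
under eq_bigr do rewrite mulrA (chiC s0) (chiC s).
by rewrite -mulr_suml sum_chi_chi eq_sym (negbTE ss0) mulr0 mul0r.
Qed.

(** Column [a] of the transition matrix is the inverse Fourier transform of [G]. Inversion turns
    revival into an equation for each [s], and multiplying by chi_s(a) leaves only a + b. *)
Lemma revival_spectrum (t : R) (a b : word) (alpha beta : R[i]) :
  transition_mx (@hamming_graph n r) t *m vertex_vec R[i] a =
    alpha *: vertex_vec R[i] a + beta *: vertex_vec R[i] b <->
  forall s, cexp (t * (krawtchouk n r (weight s))%:~R) =
    alpha + beta * chiR s (xort a b).
Proof.
pose G s := chiR s a * cexp (t * (krawtchouk n r (weight s))%:~R).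
pose u x := ((2 ^ n)%:R)^-1 * \sum_s chiR s x * G s.
have UE i : (transition_mx (@hamming_graph n r) t *m vertex_vec R[i] a) i 0 = u (enum_val i).
  rewrite -colE mxE transition_mxE enum_rankK; congr (_ * _).
  by apply: eq_bigr => s _; rewrite mulrA.
have VE i : (alpha *: vertex_vec R[i] a + beta *: vertex_vec R[i] b) i 0 =
    alpha * (enum_val i == a)%:R + beta * (enum_val i == b)%:R.
  by rewrite !mxE !andbT -!(inj_eq enum_val_inj) !enum_rankK.
have -> : transition_mx (@hamming_graph n r) t *m vertex_vec R[i] a =
    alpha *: vertex_vec R[i] a + beta *: vertex_vec R[i] b <->
    forall x, u x = alpha * (x == a)%:R + beta * (x == b)%:R.
  split=> [/matrixP E x|E]; first by have := E (enum_rank x) 0; rewrite UE VE enum_rankK.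
  by apply/matrixP => i j; rewrite ord1 UE VE.
split=> E s.
  have := chi_fourier G s.
  under eq_bigr do rewrite -/(u _) E mulrDr.
  rewrite big_split /= (bigD1 a) //= [X in _ + X + _]big1 => [|x /negbTE ->]; last by rewrite !mulr0.
  rewrite addr0 (bigD1 b) //= [X in _ + (_ + X)]big1 => [|x /negbTE ->]; last by rewrite !mulr0.
  rewrite !eqxx !mulr1 addr0 /G chi_xort rmorphM => /(congr1 ( *%R (chiR s a))).
  by rewrite mulrA chiR_sqr mul1r mulrDr mulrA chiR_sqr mul1r => <-; ring.
rewrite /u; under eq_bigr => s' _.
  rewrite /G E chi_xort rmorphM.
  rewrite (_ : _ * _ = alpha * (chiR s' s * chiR s' a) + beta * (chiR s' s * chiR s' b)); last first.
    by rewrite mulrDr mulrDr; congr (_ + _); [ring | rewrite -[chiR s' b in RHS]mul1r -(chiR_sqr s' a); ring].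
  over.
rewrite big_split /= -!mulr_sumr !sum_chi_chi mulrDr.
by have := natr_pow2_neq0; move: (2 ^ n)%:R => N N0; field.
Qed.

Lemma chi_all (s : word) : chi s (ind [set: 'I_n]) = (-1) ^+ weight s.
Proof.
rewrite /weight -prodrXr; apply: eq_bigr => i _.
by rewrite tnth_mktuple inE andbT.
Qed.

Lemma chi_ind1 (i : 'I_n) (x : word) : chi (ind [set i]) x = (-1) ^+ tnth x i.
Proof.
rewrite /chi (bigD1 i) //= tnth_mktuple inE eqxx big1 ?mulr1 // => j ji.
by rewrite tnth_mktuple inE (negbTE ji).
Qed.

(** All words of weight 1 share one eigenvalue, so the coordinates of a + b are equal, and they are
    1 because [a] and [b] differ. Conversely the zero word and the all-ones word serve. *)
Lemma revival_eigenvalues (t : R) : (0 < n)%N ->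
  balanced_fractional_revival (@hamming_graph n r) t <->
  exists alpha beta : R[i], [/\ `|alpha| = ((Num.sqrt 2)^-1)%:C,
    `|beta| = ((Num.sqrt 2)^-1)%:C &
    forall w, (w <= n)%N -> cexp (t * (krawtchouk n r w)%:~R) =
       alpha + beta * (-1) ^+ w].
Proof.
move=> n0; split=> [[a [b [alpha [beta [ab na nb /revival_spectrum E]]]]]|].
  exists alpha, beta; split=> // w wn.
  have beta0 : beta != 0.
    rewrite -normr_eq0 nb; apply/eqP => /complexI /eqP.
    by rewrite invr_eq0 sqrtr_eq0 leNgt ltr0n.
  have same i j : tnth (xort a b) i = tnth (xort a b) j.
    have := E (ind [set i]); rewrite weight_ind cards1 -(cards1 j) -weight_ind E.
    move=> /addrI /(mulfI beta0) /intr_inj; rewrite !chi_ind1.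
    by case: (tnth _ i) (tnth _ j) => [] [].
  have [i0 hi0] := neq_tnth ab.
  have c1 : xort a b = ind [set: 'I_n].
    apply: eq_from_tnth => i; rewrite (same i i0) !tnth_mktuple inE.
    by move: hi0; case: (tnth a i0) (tnth b i0) => [] [].
  have [|S _ cS] := @exists_subset_card n [set: 'I_n] w.
    by rewrite cardsT card_ord.
  have := E (ind S); rewrite c1 chi_all weight_ind cS => ->.
  by rewrite rmorphXn rmorphN1.
move=> [alpha [beta [na nb E]]].
exists (ind set0), (ind [set: 'I_n]), alpha, beta; split=> //.
  apply/eqP => /(congr1 (@weight n)); rewrite !weight_ind cards0 cardsT card_ord; lia.
apply/revival_spectrum => s.
rewrite E; last by rewrite (ind_surj s) weight_ind -[X in (_ <= X)%N]card_ord max_card.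
rewrite chi_xort chi_all; congr (_ + _ * _).
rewrite rmorphM rmorphXn rmorphN1 /= (_ : chi _ _ = 1) ?mul1r //.
by apply: big1 => i _; rewrite tnth_mktuple inE andbF.
Qed.
End Transition.

(** * Powers of a 16th root of unity *)

Section Roots.
Variable R : realType.

Lemma norm_cexp (t : R) : `|cexp t| = 1.
Proof. by rewrite normc_def /= sqrrN cos2Dsin2 sqrtr1. Qed.

Lemma cexp_neq0 (t : R) : cexp t != 0.
Proof. by rewrite -normr_eq0 norm_cexp oner_eq0. Qed.

Lemma cexpM_int (t : R) (k : int) : cexp (t * k%:~R) = cexp t ^ k.
Proof.
have H (m : nat) : cexp (t * m%:R) = cexp t ^+ m.
  elim: m => [|m IH]; first by rewrite mulr0 cexp0.
  by rewrite -natr1 mulrDr mulr1 cexpD IH exprSr.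
case: k => m; first exact: H.
rewrite NegzE -invr_expz -exprnP -H mulrNz -pmulrn.
apply: (mulfI (cexp_neq0 (t * m.+1%:R))).
by rewrite -cexpD mulfV ?cexp_neq0 // mulrN subrr cexp0.
Qed.

Local Notation w := (cexp (pi / 8%:R : R)).

Lemma cexp_pi8_exp8 : w ^+ 8 = -1.
Proof.
rewrite exprnP -cexpM_int -[_%:~R]/(8%:R) divfK ?pnatr_eq0 //.
by rewrite /cexp cospi sinpi oppr0; exact: (rmorphN1 (real_complex R)).
Qed.

(** The order divides 16 but not 8, the 8th power being -1. *)
Lemma cexp_pi8_primitive : 16.-primitive_root w.
Proof.
have w16 : w ^+ 16 = 1 by rewrite (exprM _ 8 2) cexp_pi8_exp8 sqrrN expr1n.
have [m pm] := prim_order_exists (isT : 0 < 16)%N w16.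
move=> /(dvdn_pfactor m 4 (isT : prime 2)) [k k4 mE].
move: k4; rewrite leq_eqVlt => /orP[/eqP k4|k3]; first by move: pm; rewrite mE k4.
have : w ^+ 8 == 1 by rewrite -(prim_order_dvd pm) mE -[8%N]/(2 ^ 3)%N dvdn_exp2l.
by rewrite cexp_pi8_exp8 eqNr oner_eq0.
Qed.

Lemma cexp_pi8_exp_eq1 (k : int) : w ^ k = 1 <-> exists z, k = 16 * z.
Proof.
split=> [h|[z ->]]; last first.
  by rewrite -exprz_exp -[_ ^ 16]/(_ ^+ 16) prim_expr_order ?cexp_pi8_primitive // exp1rz.
have : w ^+ `|k|%N == 1.
  case: k h => m; first by move=> /eqP.
  by rewrite NegzE -invr_expz => /(congr1 GRing.inv); rewrite invrK invr1 => /eqP.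
rewrite -(prim_order_dvd cexp_pi8_primitive) => /dvdnP [q qE].
case: k {h} qE => m /= qE; [exists q%:Z|exists (- q%:Z)]; lia.
Qed.

Lemma norm_unit_inv (x : R[i]) : `|x| = 1 -> Num.conj x = x^-1.
Proof. by move=> x1; rewrite invC_norm x1 expr1n invr1 mul1r. Qed.

(** Weights 0 and 1 force alpha = (e0 + e1) / 2 and beta = (e0 - e1) / 2. With rho = e0 / e1 the
    squared norms are (2 + rho + 1 / rho) / 4 and (2 - rho - 1 / rho) / 4, equal to 1/2 exactly when
    rho^2 = -1. *)
Lemma spectral_cond (n : nat) (K : nat -> int) : (0 < n)%N ->
  (exists alpha beta : R[i], [/\ `|alpha| = ((Num.sqrt 2)^-1)%:C,
    `|beta| = ((Num.sqrt 2)^-1)%:C &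
    forall j, (j <= n)%N -> cexp (pi / 8%:R * (K j)%:~R) =
       alpha + beta * (-1) ^+ j]) <->
  (exists z, K 0%N - K 1%N = 4 + 8 * z) /\
  (forall j, (j.+2 <= n)%N -> exists z, K j - K j.+2 = 16 * z).
Proof.
move=> n0.
have w0 : w != 0 by exact: cexp_neq0.
set e0 := w ^ K 0%N; set e1 := w ^ K 1%N.
have e00 : e0 != 0 by exact: expfz_neq0.
have e10 : e1 != 0 by exact: expfz_neq0.
have ne0 : Num.conj e0 = e0^-1 by apply: norm_unit_inv; rewrite /e0 -cexpM_int norm_cexp.
have ne1 : Num.conj e1 = e1^-1 by apply: norm_unit_inv; rewrite /e1 -cexpM_int norm_cexp.
have half_norm (x : R[i]) : `|x| = ((Num.sqrt 2)^-1)%:C <-> x * Num.conj x = 2^-1.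
  have s0 : (0 : R[i]) <= ((Num.sqrt 2 : R)^-1)%:C by rewrite ler0c invr_ge0 sqrtr_ge0.
  have s2 : ((Num.sqrt 2 : R)^-1)%:C ^+ 2 = 2^-1 :> R[i].
    by rewrite -rmorphXn exprVn sqr_sqrtr ?ler0n // fmorphV rmorph_nat.
  rewrite -normCK -s2; split=> [->//|/eqP].
  by rewrite eqrXn2 // => /eqP.
have quarter : (exists z, K 0%N - K 1%N = 4 + 8 * z) <-> (e0 / e1) ^+ 2 = -1.
  have -> : e0 / e1 = w ^ (K 0%N - K 1%N) by rewrite expfzDr // -invr_expz.
  rewrite exprnP exprz_exp -cexp_pi8_exp8 exprnP.
  split=> [[z ->]|E].
    rewrite (_ : (4 + 8 * z) * 2 = 8 + 16 * z); last by lia.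
    by rewrite expfzDr // (cexp_pi8_exp_eq1 (16 * z)).2 ?mulr1 //; exists z.
  have /cexp_pi8_exp_eq1 [z zE] : w ^ ((K 0%N - K 1%N) * 2 - 8) = 1.
    by rewrite expfzDr // -invr_expz E mulfV // expfz_neq0.
  by exists z; lia.
have step j : w ^ K j = w ^ K j.+2 <-> exists z, K j - K j.+2 = 16 * z.
  rewrite -cexp_pi8_exp_eq1 expfzDr // -invr_expz; split=> [->|E].
    by rewrite mulfV // expfz_neq0.
  by apply: (mulIf (invr_neq0 (expfz_neq0 (K j.+2) w0))); rewrite E mulfV // expfz_neq0.
rewrite quarter; split=> [[alpha [beta [na nb E]]]|[q S]].
  have E0 : e0 = alpha + beta by rewrite /e0 -cexpM_int E // expr0 mulr1.
  have E1 : e1 = alpha - beta by rewrite /e1 -cexpM_int E // expr1 mulrN1.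
  split; last first.
    move=> j jn; apply/step; rewrite -!cexpM_int !E //; last by lia.
    by rewrite -addn2 exprD sqrrN expr1n mulr1.
  have aE : 2 * alpha = e0 + e1 by rewrite E0 E1; ring.
  move/half_norm: na => /(congr1 ( *%R 4)).
  have -> : 4 * (alpha * Num.conj alpha) = (2 * alpha) * Num.conj (2 * alpha).
    by rewrite rmorphM rmorph_nat; ring.
  rewrite aE rmorphD /= ne0 ne1 => H.
  have : e0 / e1 + e1 / e0 = 0.
    transitivity ((e0 + e1) * (e0^-1 + e1^-1) - 2); first by field; rewrite ?e00 ?e10.
    by rewrite H; field.
  move=> /(congr1 ( *%R (e0 / e1))); rewrite mulr0 mulrDr => H'.
  apply/eqP; rewrite -addr_eq0; apply/eqP; rewrite -H'; by field; rewrite ?e00 ?e10.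
have eE : e0 / e1 + e1 / e0 = 0.
  transitivity (((e0 / e1) ^+ 2 + 1) * (e1 / e0)); first by field; rewrite ?e00 ?e10.
  by rewrite q addNr mul0r.
exists ((e0 + e1) / 2), ((e0 - e1) / 2); split.
- apply/half_norm; rewrite rmorphM rmorphD fmorphV rmorph_nat /= ne0 ne1.
  transitivity ((2 + (e0 / e1 + e1 / e0)) / 4); first by field; rewrite ?e00 ?e10.
  by rewrite eE; field.
- apply/half_norm; rewrite rmorphM rmorphB fmorphV rmorph_nat /= ne0 ne1.
  transitivity ((2 - (e0 / e1 + e1 / e0)) / 4); first by field; rewrite ?e00 ?e10.
  by rewrite eE; field.
move=> j; rewrite cexpM_int; elim/ltn_ind: j => -[|[|j]] IH jn.
- by rewrite expr0 -/e0; field.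
- by rewrite expr1 -/e1; field.
have /step <- := S j jn; rewrite IH; [|lia..].
by rewrite !exprS !mulN1r opprK.
Qed.

End Roots.

Theorem proposition4p12 (R : realType) (n r : nat)
    (hn : (1 <= n)%N) (hr : (1 <= r <= n)%N) :
  (connected_graph (@hamming_graph n r) /\
   balanced_fractional_revival (@hamming_graph n r) (pi / 8%:R : R)%R)
  <->
  ((odd n /\ forall a b : nat, n.-1 <> (2 ^ a * (2 ^ b - 1))%N) /\
   digits_obtained n.-1 r.-1).
Proof.
rewrite -(binomial_condition hr) -(krawtchouk_cond hr).
rewrite (@revival_eigenvalues R n r _ hn) (@spectral_cond R n (krawtchouk n r) hn).
have ro : odd r = ~~ odd r.-1 by case: r hr.
split=> [[/(connected_odd hn) cr H]|[qe H]]; split=> //; first by rewrite -ro.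
(* Connectedness needs r < n; at r = n the binomial is 1, whose valuation is 0. *)
have /(krawtchouk_cond hr) [l1 _ _] := H.
apply: odd_connected; last by rewrite ro.
case/andP: hr => r0; rewrite leq_eqVlt r0 => /orP[/eqP e|] //.
by move: l1; rewrite e binn logn1.
Qed.
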